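(* For all variational parameters $\boldsymbol{\lambda}_t,\boldsymbol{\phi}_t,\omega_t$, every data batch $\boldsymbol{x}_t$, and all previous natural parameters $\boldsymbol{\lambda}_{t-1}$, the function $\hat{\mathcal{L}}_{HPP}$ defined in the context is a lower bound for the evidence lower bound $\mathcal{L}_{HPP}$ of the hierarchical power prior model: $$\hat{\mathcal{L}}_{HPP}(\boldsymbol{\lambda}_t,\boldsymbol{\phi}_t,\omega_t\mid\boldsymbol{x}_t,\boldsymbol{\lambda}_{t-1})\;\leq\;\mathcal{L}_{HPP}(\boldsymbol{\lambda}_t,\boldsymbol{\phi}_t,\omega_t\mid\boldsymbol{x}_t,\boldsymbol{\lambda}_{t-1}).$$
   Context: Hierarchical power prior (HPP) model at time step $t$. The observed batch is $\boldsymbol{x}_t$, the local hidden variables are $\boldsymbol{Z}_t$, the global parameters are $\boldsymbol{\beta}_t$, and $\rho_t\in[0,1]$ is a random forgetting factor. The conditional model $p(\boldsymbol{x}_t,\boldsymbol{Z}_t\mid\boldsymbol{\beta}_t)$ is part of a conjugate exponential family model. Fix an exponential family of densities for the global parameters, $$g(\boldsymbol{\beta}\mid\boldsymbol{\lambda})=h(\boldsymbol{\beta})\exp\big(\boldsymbol{\lambda}^T\boldsymbol{t}(\boldsymbol{\beta})-a_g(\boldsymbol{\lambda})\big),$$ with base measure $h$, sufficient statistics $\boldsymbol{t}$, natural parameter $\boldsymbol{\lambda}$ in the natural parameter space, and log-normalizer $a_g$. Set - $p_\delta(\boldsymbol{\beta}_t\mid\boldsymbol{\lambda}_{t-1})=g(\boldsymbol{\beta}_t\mid\boldsymbol{\lambda}_{t-1})$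 (the variational posterior of the previous time step, carried over unchanged); - $p_u(\boldsymbol{\beta}_t)=g(\boldsymbol{\beta}_t\mid\boldsymbol{\alpha}_u)$ (an uninformative prior with fixed natural parameter $\boldsymbol{\alpha}_u$); - $\hat p(\boldsymbol{\beta}_t\mid\boldsymbol{\lambda}_{t-1},\rho_t)\propto p_\delta(\boldsymbol{\beta}_t\mid\boldsymbol{\lambda}_{t-1})^{\rho_t}\,p_u(\boldsymbol{\beta}_t)^{1-\rho_t}$, normalized in $\boldsymbol{\beta}_t$; thus $\hat p$ is the member of the family with natural parameter $\rho_t\boldsymbol{\lambda}_{t-1}+(1-\rho_t)\boldsymbol{\alpha}_u$. It is the conditional prior of $\boldsymbol{\beta}_t$ given $\rho_t$. The prior $p(\rho_t\mid\gamma)$ is a density on $[0,1]$ in a one-parameter exponential family with scalar natural parameter $\gamma$ (by default the exponential distribution truncated to $[0,1]$). The variational distribution is the mean-field factorization $q(\boldsymbol{\beta}_t,\boldsymbol{Z}_t,\rho_t)=q(\boldsymbol{\beta}_t\mid\boldsymbol{\lambda}_t)\,q(\boldsymbol{Z}_t\mid\boldsymbol{\phi}_t)\,q(\rho_t\mid\omega_t)$, where $q(\boldsymbol{\beta}_t\mid\boldsymbol{\lambda}_t)=g(\boldsymbol{\beta}_t\mid\boldsymbol{\lambda}_t)$ and $q(\rho_t\mid\omega_t)$ is in the same family as $p(\rho_t\mid\gamma)$, with scalar natural parameter $\omega_t$. $\mathbb{E}_q$ denotes expectation under $q$; all expectations below are assumed to be well defined and finite. The evidence lower bound is $$\mathcal{L}_{HPP}(\boldsymbol{\lambda}_t,\boldsymbol{\phi}_t,\omega_t\mid\boldsymbol{x}_t,\boldsymbol{\lambda}_{t-1})=\mathbb{E}_q[\ln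 p(\boldsymbol{x}_t,\boldsymbol{Z}_t\mid\boldsymbol{\beta}_t)]+\mathbb{E}_q[\ln\hat p(\boldsymbol{\beta}_t\mid\boldsymbol{\lambda}_{t-1},\rho_t)]+\mathbb{E}_q[\ln p(\rho_t\mid\gamma)]-\mathbb{E}_q[\ln q(\boldsymbol{Z}_t\mid\boldsymbol{\phi}_t)]-\mathbb{E}_q[\ln q(\boldsymbol{\beta}_t\mid\boldsymbol{\lambda}_t)]-\mathbb{E}_q[\ln q(\rho_t\mid\omega_t)],$$ and $$\hat{\mathcal{L}}_{HPP}(\boldsymbol{\lambda}_t,\boldsymbol{\phi}_t,\omega_t\mid\boldsymbol{x}_t,\boldsymbol{\lambda}_{t-1})=\mathbb{E}_q[\ln p(\boldsymbol{x}_t,\boldsymbol{Z}_t\mid\boldsymbol{\beta}_t)]+\mathbb{E}_q[\rho_t]\,\mathbb{E}_q[\ln p_\delta(\boldsymbol{\beta}_t\mid\boldsymbol{\lambda}_{t-1})]+(1-\mathbb{E}_q[\rho_t])\,\mathbb{E}_q[\ln p_u(\boldsymbol{\beta}_t)]+\mathbb{E}_q[\ln p(\rho_t\mid\gamma)]-\mathbb{E}_q[\ln q(\boldsymbol{Z}_t\mid\boldsymbol{\phi}_t)]-\mathbb{E}_q[\ln q(\boldsymbol{\beta}_t\mid\boldsymbol{\lambda}_t)]-\mathbb{E}_q[\ln q(\rho_t\mid\omega_t)].$$ *)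

(* Defs.v *)
From HB Require Import structures.
From mathcomp Require Import all_boot all_order all_algebra.
From mathcomp Require Import all_classical all_reals all_analysis.
Set Implicit Arguments.
Unset Strict Implicit.
Unset Printing Implicit Defensive.
Import Order.TTheory GRing.Theory Num.Theory.
Local Open Scope classical_set_scope.
Local Open Scope ring_scope.
Local Open Scope ereal_scope.

(* lambda^T t *)
Definition dotv (R : realType) (n : nat) (u v : 'rV[R]_n) : R :=
  (u *m v^T)%R ord0 ord0.

(* [mu] is the measure with respect to which densities are taken; the carrier
   measure of the family is therefore [ef_base times mu]. *)
Record expfam (R : realType) (d : measure_display) (T : measurableType d)
    (mu : {measure set T -> \bar R}) (n : nat) : Type := ExpFam {
  ef_base : T -> R ;
  ef_stat : T -> 'rV[R]_n ;
  ef_base_ge0 : forall x, (0 <= ef_base x)%R ;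
  ef_base_measurable : measurable_fun [set: T] ef_base ;
  ef_stat_measurable : forall i,
    measurable_fun [set: T] (fun x => ef_stat x ord0 i) }.

Definition ef_partition (R : realType) (d : measure_display)
    (T : measurableType d) (mu : {measure set T -> \bar R})
    (n : nat) (F : expfam mu n) (lam : 'rV[R]_n) : \bar R :=
  \int[mu]_x (ef_base F x * expR (dotv lam (ef_stat F x)))%:E.

(* Positivity of the partition function only excludes a base function that
   vanishes [mu]-almost everywhere, for which there is no density at all. *)
Definition natural_space (R : realType) (d : measure_display)
    (T : measurableType d) (mu : {measure set T -> \bar R})
    (n : nat) (F : expfam mu n) : set 'rV[R]_n :=
  [set lam | 0 < ef_partition F lam < +oo].

Definition log_normalizer (R : realType) (d : measure_display)
    (T : measurableType d) (mu : {measure set T -> \bar R})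
    (n : nat) (F : expfam mu n) (lam : 'rV[R]_n) : R :=
  ln (fine (ef_partition F lam)).

Definition ef_density (R : realType) (d : measure_display)
    (T : measurableType d) (mu : {measure set T -> \bar R})
    (n : nat) (F : expfam mu n) (lam : 'rV[R]_n) (x : T) : R :=
  (ef_base F x * expR (dotv lam (ef_stat F x) - log_normalizer F lam))%R.

Definition is_density (R : realType) (d : measure_display)
    (T : measurableType d) (mu : {measure set T -> \bar R})
    (f : T -> R) : Prop :=
  [/\ measurable_fun [set: T] f, forall x, (0 <= f x)%R
    & \int[mu]_x (f x)%:E = 1].

(* The likelihood family [L], used with natural parameter [eta b], is conjugate
   to the family [G] on the parameter [b]: the log-likelihood
     ln h_l(y) + eta(b)^T s(y) - a_l(eta(b))
   depends on [b] only through a linear function of the sufficient statistic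
   t(b) of [G]. The textbook normal form t(b) = (eta(b), - a_l(eta(b))) is the
   case where [A] and [v] are coordinate maps up to sign. Only parameters [b] in
   the support of [G] matter. *)
Definition conjugate_to (R : realType) (dB dY : measure_display)
    (TB : measurableType dB) (TY : measurableType dY)
    (mu : {measure set TB -> \bar R})
    (ups : {measure set TY -> \bar R}) (n k : nat)
    (L : expfam ups k) (eta : TB -> 'rV[R]_k) (G : expfam mu n) : Prop :=
  exists (A : 'M[R]_(n, k)) (v : 'rV[R]_n), forall b,
    (0 < ef_base G b)%R ->
    eta b = (ef_stat G b *m A)%R /\
    log_normalizer L (eta b) = dotv v (ef_stat G b).

(* [TX], [TZ], [TB] are the spaces of the data batch, of the local hidden
   variables and of the global parameters, with arbitrary sigma-finite reference
   measures, so that discrete and continuous variables are both covered; the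
   forgetting factor has a density with respect to Lebesgue measure. *)
Record hpp_model (R : realType) (dX dZ dB : measure_display)
    (TX : measurableType dX) (TZ : measurableType dZ) (TB : measurableType dB)
    (n k : nat) : Type := HPPModel {
  refX : {sigma_finite_measure set TX -> \bar R} ;
  refZ : {sigma_finite_measure set TZ -> \bar R} ;
  refB : {sigma_finite_measure set TB -> \bar R} ;
  global_fam : expfam refB n ;
  lik_fam : expfam (refX \x refZ) k ;
  lik_param : TB -> 'rV[R]_k ;
  lik_paramP : forall b, (0 < ef_base global_fam b)%R ->
    natural_space lik_fam (lik_param b) ;
  lik_conjugate : conjugate_to lik_fam lik_param global_fam ;
  alpha_u : 'rV[R]_n ;
  alpha_uP : natural_space global_fam alpha_u ;
  rho_fam : expfam (@lebesgue_measure R) 1 ;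
  rho_fam_supp : forall r : R, ~~ (0 <= r <= 1)%R -> ef_base rho_fam r = 0%R ;
  rho_nat : R ;
  rho_natP : natural_space rho_fam (rho_nat%:M)%R ;
  phi_index : Type ;
  qZ : phi_index -> TZ -> R ;
  qZP : forall phi, is_density refZ (qZ phi) }.

Section HPP.
Context (R : realType) (dX dZ dB : measure_display)
  (TX : measurableType dX) (TZ : measurableType dZ) (TB : measurableType dB)
  (n k : nat) (M : hpp_model R TX TZ TB n k).

Definition lik (x : TX) (z : TZ) (b : TB) : R :=
  ef_density (lik_fam M) (lik_param M b) (x, z).

Definition p_delta (lam : 'rV[R]_n) (b : TB) : R :=
  ef_density (global_fam M) lam b.

Definition p_u (b : TB) : R := ef_density (global_fam M) (alpha_u M) b.

(* Where the base function vanishes, [0 `^ 0 = 1] occurs at [r = 0] and [r = 1],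
   but the other factor of the product is then [0]. *)
Definition p_hat (lam : 'rV[R]_n) (r : R) (b : TB) : R :=
  (p_delta lam b `^ r * p_u b `^ (1 - r) /
   (\int[refB M]_b' (p_delta lam b' `^ r * p_u b' `^ (1 - r))))%R.

Definition p_rho (r : R) : R := ef_density (rho_fam M) ((rho_nat M)%:M)%R r.

Definition q_beta (lam : 'rV[R]_n) (b : TB) : R :=
  ef_density (global_fam M) lam b.

Definition q_Z (phi : phi_index M) (z : TZ) : R := qZ phi z.

Definition q_rho (omega : R) (r : R) : R :=
  ef_density (rho_fam M) (omega%:M)%R r.

Definition q_joint (lam : 'rV[R]_n) (phi : phi_index M) (omega : R)
    (y : TB * TZ * measurableTypeR R) : R :=
  (q_beta lam y.1.1 * q_Z phi y.1.2 * q_rho omega y.2)%R.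

(* Logarithms are taken in the extended reals ([lne 0 = -oo]); points where
   the variational density vanishes contribute nothing, as [0 * -oo = 0]. *)
Definition expect_q_integrand (lam : 'rV[R]_n) (phi : phi_index M) (omega : R)
    (f : TB -> TZ -> R -> \bar R) (y : TB * TZ * measurableTypeR R) : \bar R :=
  (q_joint lam phi omega y)%:E * f y.1.1 y.1.2 y.2.

Definition expect_q (lam : 'rV[R]_n) (phi : phi_index M) (omega : R)
    (f : TB -> TZ -> R -> \bar R) : \bar R :=
  \int[(refB M \x refZ M) \x @lebesgue_measure R]_y
    expect_q_integrand lam phi omega f y.

Definition expect_q_finite (lam : 'rV[R]_n) (phi : phi_index M) (omega : R)
    (f : TB -> TZ -> R -> \bar R) : Prop :=
  ((refB M \x refZ M) \x @lebesgue_measure R).-integrable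
    [set: TB * TZ * measurableTypeR R] (expect_q_integrand lam phi omega f).

Definition expectations_finite (lam : 'rV[R]_n) (phi : phi_index M) (omega : R)
    (x : TX) (lam_prev : 'rV[R]_n) : Prop :=
  let fin := expect_q_finite lam phi omega in
  fin (fun b z _ => lne (lik x z b)%:E) /\
  fin (fun b _ r => lne (p_hat lam_prev r b)%:E) /\
  fin (fun b _ _ => lne (p_delta lam_prev b)%:E) /\
  fin (fun b _ _ => lne (p_u b)%:E) /\
  fin (fun _ _ r => r%:E) /\
  fin (fun _ _ r => lne (p_rho r)%:E) /\
  fin (fun _ z _ => lne (q_Z phi z)%:E) /\
  fin (fun b _ _ => lne (q_beta lam b)%:E) /\
  fin (fun _ _ r => lne (q_rho omega r)%:E).

Definition L_HPP (lam : 'rV[R]_n) (phi : phi_index M) (omega : R)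
    (x : TX) (lam_prev : 'rV[R]_n) : \bar R :=
  let E := expect_q lam phi omega in
  E (fun b z _ => lne (lik x z b)%:E)
  + E (fun b _ r => lne (p_hat lam_prev r b)%:E)
  + E (fun _ _ r => lne (p_rho r)%:E)
  - E (fun _ z _ => lne (q_Z phi z)%:E)
  - E (fun b _ _ => lne (q_beta lam b)%:E)
  - E (fun _ _ r => lne (q_rho omega r)%:E).

Definition Lhat_HPP (lam : 'rV[R]_n) (phi : phi_index M) (omega : R)
    (x : TX) (lam_prev : 'rV[R]_n) : \bar R :=
  let E := expect_q lam phi omega in
  E (fun b z _ => lne (lik x z b)%:E)
  + E (fun _ _ r => r%:E) * E (fun b _ _ => lne (p_delta lam_prev b)%:E)
  + (1 - E (fun _ _ r => r%:E)) * E (fun b _ _ => lne (p_u b)%:E)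
  + E (fun _ _ r => lne (p_rho r)%:E)
  - E (fun _ z _ => lne (q_Z phi z)%:E)
  - E (fun b _ _ => lne (q_beta lam b)%:E)
  - E (fun _ _ r => lne (q_rho omega r)%:E).

End HPP.

(* Main.v *)
(** Wherever the variational density is positive,
    [ln p_hat = rho * ln p_delta + (1 - rho) * ln p_u - ln Z(rho)], where
    [Z(rho)] is the integral of [p_delta ^ rho * p_u ^ (1 - rho)]. By weighted
    AM-GM, [Z(rho) <= 1], so [- ln Z(rho) >= 0]; moreover [Z(rho) > 0] since the
    two densities have the same support, so that [p_hat] is not a junk quotient
    by [0]. Integrating against the mean-field density, under which [beta] and
    [rho] are independent, factors the expectation of the first two terms. *)
From HB Require Import structures.
Require Import Defs.
From mathcomp Require Import all_boot all_order all_algebra.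
From mathcomp Require Import all_classical all_reals all_analysis.
From mathcomp Require Import measurable_realfun ring.
Set Implicit Arguments.
Unset Strict Implicit.
Unset Printing Implicit Defensive.
Import Order.TTheory GRing.Theory Num.Theory.
Local Open Scope classical_set_scope.
Local Open Scope ring_scope.
Local Open Scope ereal_scope.

(** * Integrals of products of one-variable functions over product measures *)

Lemma ge0_integral_prod (R : realType) (d1 d2 : measure_display)
    (T1 : measurableType d1) (T2 : measurableType d2)
    (m1 : {sigma_finite_measure set T1 -> \bar R})
    (m2 : {sigma_finite_measure set T2 -> \bar R}) (f : T1 -> R) (g : T2 -> R) :
  measurable_fun [set: T1] f -> measurable_fun [set: T2] g ->
  (forall x, 0 <= f x)%R -> (forall y, 0 <= g y)%R ->
  \int[m1 \x m2]_z (f z.1 * g z.2)%:E =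
  (\int[m1]_x (f x)%:E) * (\int[m2]_y (g y)%:E).
Proof.
move=> mf mg f0 g0.
have mfg : measurable_fun [set: T1 * T2] (fun z => (f z.1 * g z.2)%R).
  by apply: measurable_funM; apply: measurableT_comp.
rewrite fubini_tonelli1 /fubini_F /=; first last.
- by move=> z; rewrite lee_fin mulr_ge0.
- exact/measurable_EFinP.
under eq_integral => x _ do
  (under eq_integral => y _ do rewrite EFinM;
   rewrite ge0_integralZl_EFin//; [|by move=> y _; rewrite lee_fin|exact/measurable_EFinP]).
by rewrite ge0_integralZr//; [exact/measurable_EFinP|move=> x _; rewrite lee_fin|
  apply: integral_ge0 => y _; rewrite lee_fin].
Qed.

(** Tonelli applied to the absolute values gives integrability, after which Fubini factors the
    signed integral. *)
Lemma integrable_integral_prod (R : realType) (d1 d2 : measure_display)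
    (T1 : measurableType d1) (T2 : measurableType d2)
    (m1 : {sigma_finite_measure set T1 -> \bar R})
    (m2 : {sigma_finite_measure set T2 -> \bar R}) (f : T1 -> R) (g : T2 -> R) :
  m1.-integrable [set: T1] (fun x => (f x)%:E) ->
  m2.-integrable [set: T2] (fun y => (g y)%:E) ->
  (m1 \x m2).-integrable [set: T1 * T2] (fun z => (f z.1 * g z.2)%:E) /\
  \int[m1 \x m2]_z (f z.1 * g z.2)%:E =
  (\int[m1]_x (f x)%:E) * (\int[m2]_y (g y)%:E).
Proof.
move=> intf intg.
have mf : measurable_fun [set: T1] f by exact/measurable_EFinP/(measurable_int _ intf).
have mg : measurable_fun [set: T2] g by exact/measurable_EFinP/(measurable_int _ intg).
have intfg : (m1 \x m2).-integrable [set: T1 * T2] (fun z => (f z.1 * g z.2)%:E).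
  apply/integrableP; split.
    apply/measurable_EFinP.
    by apply: measurable_funM; apply: measurableT_comp.
  under eq_integral => z _ do rewrite abse_EFin normrM.
  rewrite (@ge0_integral_prod _ _ _ _ _ m1 m2 (fun x => `|f x|%R) (fun y => `|g y|%R))//.
  - apply: lte_mul_pinfty; first by apply: integral_ge0 => ? _; rewrite lee_fin.
    + rewrite ge0_fin_numE; last by apply: integral_ge0 => ? _; rewrite lee_fin.
      by case/integrableP : intf.
    + by case/integrableP : intg.
  - exact: measurableT_comp.
  - exact: measurableT_comp.
split => //.
rewrite -integral12_prod_meas1 //= /fubini_F /=.
under eq_integral => x _ do
  (under eq_integral => y _ do rewrite EFinM; rewrite integralZl//).
(* The inner integral is finite, so it can be pulled out as a real scalar. *)
have [c ->] : exists c : R, \int[m2]_y (g y)%:E = c%:E.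
  by exists (fine (\int[m2]_y (g y)%:E)); rewrite fineK// integrable_fin_num.
under eq_integral => x _ do rewrite muleC.
by rewrite integralZl// muleC.
Qed.

(* The library declares this structure on [m1 \x m2] too, but there it is shadowed
   by the canonical structure for products of subprobabilities. *)
Definition prod_sigma_finite (R : realType) (d1 d2 : measure_display)
    (T1 : measurableType d1) (T2 : measurableType d2)
    (m1 : {sigma_finite_measure set T1 -> \bar R})
    (m2 : {sigma_finite_measure set T2 -> \bar R}) :
    {sigma_finite_measure set (T1 * T2)%type -> \bar R} :=
  HB.pack (m1 \x m2)
    (lebesgue_integral_fubini.measure_function_Measure_isSigmaFinite__to__measure_function_isSigmaFinite m1 m2)
    (lebesgue_integral_fubini.measure_function_Measure_isSigmaFinite__to__measure_function_isSFinite m1 m2).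

Lemma integrable_integral_prod3 (R : realType) (d1 d2 d3 : measure_display)
    (T1 : measurableType d1) (T2 : measurableType d2) (T3 : measurableType d3)
    (m1 : {sigma_finite_measure set T1 -> \bar R})
    (m2 : {sigma_finite_measure set T2 -> \bar R})
    (m3 : {sigma_finite_measure set T3 -> \bar R})
    (f : T1 -> R) (g : T2 -> R) (h : T3 -> R) :
  m1.-integrable [set: T1] (fun x => (f x)%:E) ->
  m2.-integrable [set: T2] (fun y => (g y)%:E) ->
  m3.-integrable [set: T3] (fun z => (h z)%:E) ->
  ((m1 \x m2) \x m3).-integrable [set: T1 * T2 * T3]
    (fun w => (f w.1.1 * g w.1.2 * h w.2)%:E) /\
  \int[(m1 \x m2) \x m3]_w (f w.1.1 * g w.1.2 * h w.2)%:E =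
  (\int[m1]_x (f x)%:E) * (\int[m2]_y (g y)%:E) * (\int[m3]_z (h z)%:E).
Proof.
move=> intf intg inth.
have [intfg Efg] := integrable_integral_prod intf intg.
rewrite -Efg.
exact: (@integrable_integral_prod _ _ _ _ _ (prod_sigma_finite m1 m2) m3
  (fun v => (f v.1 * g v.2)%R)).
Qed.

Lemma integrable_density (R : realType) (d : measure_display)
    (T : measurableType d) (mu : {measure set T -> \bar R}) (f : T -> R) :
  is_density mu f -> mu.-integrable [set: T] (fun x => (f x)%:E).
Proof.
move=> [mf f0 f1]; apply/integrableP; split; first exact/measurable_EFinP.
by under eq_integral => x _ do rewrite gee0_abs ?lee_fin//; rewrite f1 ltry.
Qed.

(** Since [g] and [h] are nonnegative of mass 1, Tonelli identifies the integral of the absolute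
    value of the product with that of the absolute value of [f]. This transfers finiteness of an
    expectation under the joint density to a single factor. *)
Lemma integrable_prod3_density (R : realType) (d1 d2 d3 : measure_display)
    (T1 : measurableType d1) (T2 : measurableType d2) (T3 : measurableType d3)
    (m1 : {sigma_finite_measure set T1 -> \bar R})
    (m2 : {sigma_finite_measure set T2 -> \bar R})
    (m3 : {sigma_finite_measure set T3 -> \bar R})
    (f : T1 -> R) (g : T2 -> R) (h : T3 -> R) :
  measurable_fun [set: T1] f -> is_density m2 g -> is_density m3 h ->
  ((m1 \x m2) \x m3).-integrable [set: T1 * T2 * T3]
    (fun w => (f w.1.1 * g w.1.2 * h w.2)%:E) ->
  m1.-integrable [set: T1] (fun x => (f x)%:E).
Proof.
move=> mf [mg g0 g1] [mh h0 h1] /integrableP[_].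
have mfa : measurable_fun [set: T1] (fun x => `|f x|%R) by exact: measurableT_comp.
under eq_integral => w _ do
  rewrite abse_EFin !normrM (ger0_norm (g0 _)) (ger0_norm (h0 _)).
rewrite (@ge0_integral_prod _ _ _ _ _ (prod_sigma_finite m1 m2) m3
           (fun v => (`|f v.1| * g v.2)%R) h)//; first last.
- by move=> ?; rewrite mulr_ge0.
- apply: measurable_funM; [exact: (measurableT_comp mfa)|exact: measurableT_comp].
rewrite (@ge0_integral_prod _ _ _ _ _ m1 m2 (fun x => `|f x|%R) g)// g1 h1 !mule1.
by move=> fy; apply/integrableP; split; first exact/measurable_EFinP.
Qed.

(** * Densities of an exponential family *)

Lemma measurable_dotv (R : realType) (d : measure_display)
    (T : measurableType d) (n : nat) (u : 'rV[R]_n) (t : T -> 'rV[R]_n) :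
  (forall i, measurable_fun [set: T] (fun x => t x ord0 i)) ->
  measurable_fun [set: T] (fun x => dotv u (t x)).
Proof.
move=> mt; rewrite /dotv.
under eq_fun => x do
  (rewrite mxE; under eq_bigr => j _ do rewrite mxE).
by apply: measurable_sum => i; exact: measurable_funM.
Qed.

(** A partition function in the open interval from 0 to [+oo] is what makes [expR] of minus the
    log-normalizer its inverse; outside it, [fine] and [ln] return default values. *)
Lemma ef_densityE (R : realType) (d : measure_display)
    (T : measurableType d) (mu : {measure set T -> \bar R}) (n : nat)
    (F : expfam mu n) (lam : 'rV[R]_n) (x : T) : natural_space F lam ->
  ef_density F lam x = ((fine (ef_partition F lam))^-1 *
    (ef_base F x * expR (dotv lam (ef_stat F x))))%R.
Proof.
move=> /andP[P0 Py]; rewrite /ef_density /log_normalizer expRB lnK.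
  by rewrite mulrA mulrC.
by rewrite posrE fine_gt0// P0 Py.
Qed.

Lemma ef_density_is_density (R : realType) (d : measure_display)
    (T : measurableType d) (mu : {measure set T -> \bar R}) (n : nat)
    (F : expfam mu n) (lam : 'rV[R]_n) :
  natural_space F lam -> is_density mu (ef_density F lam).
Proof.
move=> Flam; have mbe : measurable_fun [set: T]
    (fun x => (ef_base F x * expR (dotv lam (ef_stat F x)))%R).
  apply: measurable_funM; first exact: ef_base_measurable.
  apply: measurableT_comp => //.
  by apply: measurable_dotv; exact: ef_stat_measurable.
have /andP[P0 Py] := Flam.
split.
- rewrite (funext (fun x => ef_densityE x Flam)).
  exact: measurable_funM.
- by move=> x; rewrite mulr_ge0 ?expR_ge0 ?ef_base_ge0.
- under eq_integral => x _ do rewrite (ef_densityE _ Flam) EFinM.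
  rewrite ge0_integralZl_EFin//.
  + rewrite -[X in _ * X]fineK; last by rewrite ge0_fin_numE// ltW.
    by rewrite -EFinM mulVf// gt_eqF// fine_gt0// P0 Py.
  + by move=> x _; rewrite lee_fin mulr_ge0 ?expR_ge0 ?ef_base_ge0.
  + exact/measurable_EFinP.
  + by rewrite invr_ge0 fine_ge0// ltW.
Qed.

(** The exponential factor never vanishes, so all members of a family share the support of the base
    function. *)
Lemma ef_density_gt0 (R : realType) (d : measure_display)
    (T : measurableType d) (mu : {measure set T -> \bar R}) (n : nat)
    (F : expfam mu n) (lam : 'rV[R]_n) (x : T) :
  (0 < ef_density F lam x)%R = (0 < ef_base F x)%R.
Proof. by rewrite /ef_density pmulr_lgt0// expR_gt0. Qed.

(** * Weighted AM-GM and the normalizer of the power prior *)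

(** For positive [a] and [b] this is convexity of [expR] between [ln a] and [ln b]; zero values are
    treated apart, as [ln 0] is a default. *)
Lemma powR_le_mix (R : realType) (a b r : R) :
  (0 <= a)%R -> (0 <= b)%R -> (0 <= r <= 1)%R ->
  (a `^ r * b `^ (1 - r) <= r * a + (1 - r) * b)%R.
Proof.
move=> a0 b0 r01; have /andP[r0 r1] := r01.
move: a0; rewrite le_eqVlt => /predU1P[<-|a0].
  (* Zero to the power zero is 1, so the endpoint gives equality; for any other [r] the left side
     vanishes. *)
  have [->|rN0] := eqVneq r 0%R.
    by rewrite subr0 powRr0 powRr1// mulr0 add0r.
  by rewrite powR0// mul0r mulr0 add0r mulr_ge0// subr_ge0.
move: b0; rewrite le_eqVlt => /predU1P[<-|b0].
  have [->|rN1] := eqVneq r 1%R.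
    by rewrite subrr powRr0 (powRr1 (ltW a0)) mulr1 mul1r mulr0 addr0.
  rewrite powR0; last by rewrite subr_eq0 eq_sym.
  by rewrite !mulr0 addr0 mulr_ge0// ltW.
rewrite /powR !gt_eqF// -expRD.
have := @convex_expR R (Itv01 r0 r1) (ln a) (ln b).
by rewrite !convRE /= !lnK.
Qed.

(** The upper bound integrates AM-GM against two densities of mass 1. For the lower bound, a zero
    integral would force the integrand, and with it [f], to vanish almost everywhere, against the
    mass 1 of [f]. *)
Lemma Rintegral_powR_mix (R : realType) (d : measure_display)
    (T : measurableType d) (mu : {measure set T -> \bar R}) (f g : T -> R) (r : R) :
  is_density mu f -> is_density mu g -> (forall x, 0 < f x -> 0 < g x)%R ->
  (0 <= r <= 1)%R ->
  (0 < \int[mu]_x (f x `^ r * g x `^ (1 - r)) <= 1)%R.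
Proof.
move=> [mf f0 f1] [mg g0 g1] fg r01; have /andP[r0 r1] := r01.
pose h x := (f x `^ r * g x `^ (1 - r))%R.
have h0 x : (0 <= h x)%R by rewrite mulr_ge0// powR_ge0.
have mh : measurable_fun [set: T] h.
  apply: measurable_funM.
  - exact: (measurableT_comp (measurable_powR r) mf).
  - exact: (measurableT_comp (measurable_powR (1 - r)%R) mg).
have mhE : measurable_fun [set: T] (fun x => (h x)%:E) by exact/measurable_EFinP.
have ih1 : \int[mu]_x (h x)%:E <= 1.
  have -> : 1 = \int[mu]_x (r%:E * (f x)%:E + (1 - r)%:E * (g x)%:E) :> \bar R.
    rewrite integralD//=; first last.
    - by apply: integrableZl => //; apply: integrable_density.
    - by apply: integrableZl => //; apply: integrable_density.
    rewrite !integralZl//; [|exact: integrable_density..].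
    by rewrite f1 g1 !mule1 -EFinD subrKC.
  apply: ge0_le_integral => //.
  - by move=> x _; rewrite lee_fin.
  - apply/measurable_EFinP; apply: measurable_funD; exact: measurable_funM.
  - by move=> x _; rewrite -!EFinM -EFinD lee_fin powR_le_mix.
have ih0 : 0 <= \int[mu]_x (h x)%:E by apply: integral_ge0 => x _; rewrite lee_fin.
have ihN0 : \int[mu]_x (h x)%:E != 0.
  apply/eqP => ih; have : ae_eq mu [set: T] (fun x => (h x)%:E) (cst 0).
    apply/ae_eq_integral_abs => //.
    by under eq_integral => x _ do rewrite gee0_abs ?lee_fin//.
  move=> hae; have fae : ae_eq mu [set: T] (fun x => (f x)%:E) (cst 0).
    apply: filterS hae => x /(_ I)[hx] _ /=; congr EFin.
    apply/eqP; rewrite eq_le f0 andbT leNgt; apply/negP => fx0.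
    have : (0 < h x)%R by rewrite mulr_gt0// powR_gt0// fg.
    by rewrite hx ltxx.
  have : \int[mu]_x (f x)%:E = 0.
    rewrite (ae_eq_integral (cst 0) _ _ _ _ fae)//; last exact/measurable_EFinP.
    by rewrite integral0.
  by rewrite f1 => /eqP; rewrite onee_eq0.
(* The real integral is [fine] of the extended one and [fine] sends [+oo] to 0, so positivity
   carries over only once finiteness is known. *)
have ihfin : \int[mu]_x (h x)%:E \is a fin_num.
  by rewrite ge0_fin_numE// (le_lt_trans ih1)// ltry.
rewrite /Rintegral -lte_fin -lee_fin fineK// ih1 andbT.
by rewrite lt_neqAle eq_sym ihN0.
Qed.


(** * Expectations under a mean-field density *)

(** Marginalization. [F] stands for an extended logarithm, possibly [-oo] where [p] vanishes; as
    [0 * -oo = 0], it can be replaced by the real-valued [f]. *)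
Lemma integral_prod3_density_mul (R : realType) (d1 d2 d3 : measure_display)
    (T1 : measurableType d1) (T2 : measurableType d2) (T3 : measurableType d3)
    (m1 : {sigma_finite_measure set T1 -> \bar R})
    (m2 : {sigma_finite_measure set T2 -> \bar R})
    (m3 : {sigma_finite_measure set T3 -> \bar R})
    (p : T1 -> R) (q : T2 -> R) (s : T3 -> R) (F : T1 -> \bar R) (f : T1 -> R) :
  is_density m1 p -> is_density m2 q -> is_density m3 s ->
  measurable_fun [set: T1] f -> (forall x, (0 < p x)%R -> F x = (f x)%:E) ->
  ((m1 \x m2) \x m3).-integrable [set: T1 * T2 * T3]
    (fun w => (p w.1.1 * q w.1.2 * s w.2)%:E * F w.1.1) ->
  m1.-integrable [set: T1] (fun x => (p x * f x)%:E) /\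
  \int[(m1 \x m2) \x m3]_w ((p w.1.1 * q w.1.2 * s w.2)%:E * F w.1.1) =
  \int[m1]_x (p x * f x)%:E.
Proof.
move=> [mp p0 _] dq ds mf pF; have [_ _ q1] := dq; have [_ _ s1] := ds.
have -> : (fun w : T1 * T2 * T3 => (p w.1.1 * q w.1.2 * s w.2)%:E * F w.1.1) =
    (fun w => (p w.1.1 * f w.1.1 * q w.1.2 * s w.2)%:E).
  apply/funext => -[[x y] z] /=.
  have := p0 x; rewrite le_eqVlt => /predU1P[<-|px]; first by rewrite !mul0r mul0e.
  by rewrite pF// -EFinM; congr EFin; ring.
move=> ipf.
have mpf : measurable_fun [set: T1] (fun x => p x * f x)%R by exact: measurable_funM.
have ipf1 : m1.-integrable [set: T1] (fun x => (p x * f x)%:E).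
  exact: (integrable_prod3_density mpf dq ds).
split=> //.
have [_ ->] := integrable_integral_prod3 ipf1 (integrable_density dq)
  (integrable_density ds).
by rewrite q1 s1 !mule1.
Qed.

(** The inequality on the prior term in abstract form: [F] and [G] are the two log-densities, [t] is
    the mixing weight and [H] the log of the power prior. A pointwise bound on the support is
    integrated, and independence factors its left side. *)
Lemma expectation_mix_le (R : realType) (d1 d2 d3 : measure_display)
    (T1 : measurableType d1) (T2 : measurableType d2) (T3 : measurableType d3)
    (m1 : {sigma_finite_measure set T1 -> \bar R})
    (m2 : {sigma_finite_measure set T2 -> \bar R})
    (m3 : {sigma_finite_measure set T3 -> \bar R})
    (p : T1 -> R) (q : T2 -> R) (s : T3 -> R) (F G : T1 -> \bar R)
    (f g : T1 -> R) (t : T3 -> R) (H : T1 -> T3 -> \bar R) :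
  let mu := (m1 \x m2) \x m3 in
  let pqs w := (p w.1.1 * q w.1.2 * s w.2)%R in
  is_density m1 p -> is_density m2 q -> is_density m3 s ->
  measurable_fun [set: T1] f -> (forall x, (0 < p x)%R -> F x = (f x)%:E) ->
  measurable_fun [set: T1] g -> (forall x, (0 < p x)%R -> G x = (g x)%:E) ->
  measurable_fun [set: T3] t -> (forall z, (0 < s z)%R -> (0 <= t z <= 1)%R) ->
  (forall x z, (0 < p x)%R -> (0 < s z)%R ->
    (t z * f x + (1 - t z) * g x)%:E <= H x z) ->
  mu.-integrable [set: T1 * T2 * T3] (fun w => (pqs w)%:E * F w.1.1) ->
  mu.-integrable [set: T1 * T2 * T3] (fun w => (pqs w)%:E * G w.1.1) ->
  mu.-integrable [set: T1 * T2 * T3] (fun w => (pqs w)%:E * H w.1.1 w.2) ->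
  \int[mu]_w ((pqs w)%:E * (t w.2)%:E) * \int[mu]_w ((pqs w)%:E * F w.1.1) +
  (1 - \int[mu]_w ((pqs w)%:E * (t w.2)%:E)) * \int[mu]_w ((pqs w)%:E * G w.1.1)
  <= \int[mu]_w ((pqs w)%:E * H w.1.1 w.2).
Proof.
move=> mu pqs dp dq ds mf pF mg pG mt t01 fgH iF iG iH.
have [mp p0 p1] := dp; have [_ q0 q1] := dq; have [ms s0 s1] := ds.
have [ipf ->] := integral_prod3_density_mul dp dq ds mf pF iF.
have [ipg ->] := integral_prod3_density_mul dp dq ds mg pG iG.
have is_ := integrable_density ds; have iq := integrable_density dq.
(* Absorbing the weights [t] and [1 - t] into [s] turns each term of the mixture into a product of
   three one-variable functions. *)
pose st z := (s z * t z)%R; pose sn z := (s z * (1 - t z))%R.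
have ist : m3.-integrable [set: T3] (fun z => (st z)%:E).
  apply: (le_integrable _ _ _ is_) => //.
    by apply/measurable_EFinP; exact: measurable_funM.
  move=> z _; rewrite !abse_EFin lee_fin normrM.
  have := s0 z; rewrite le_eqVlt => /predU1P[<-|sz]; first by rewrite normr0 mul0r.
  have /andP[? ?] := t01 _ sz.
  by rewrite ler_piMr// ger0_norm.
have snE : (fun z => (sn z)%:E) = (fun z => (s z)%:E - (st z)%:E).
  by apply/funext => z; rewrite -EFinB /st /sn mulrBr mulr1.
have isn : m3.-integrable [set: T3] (fun z => (sn z)%:E).
  by rewrite snE; apply: integrableB.
have -> : \int[mu]_w ((pqs w)%:E * (t w.2)%:E) = \int[m3]_z (st z)%:E.
  transitivity (\int[mu]_w (p w.1.1 * q w.1.2 * st w.2)%:E).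
    by apply: eq_integral => w _; rewrite -EFinM /pqs /st !mulrA.
  have [_ ->] := integrable_integral_prod3 (integrable_density dp) iq ist.
  by rewrite p1 q1 !mul1e.
have -> : 1 - \int[m3]_z (st z)%:E = \int[m3]_z (sn z)%:E.
  by rewrite snE integralB// s1.
have [i1 E1] := integrable_integral_prod3 ipf iq ist.
have [i2 E2] := integrable_integral_prod3 ipg iq isn.
have -> : \int[m3]_z (st z)%:E * \int[m1]_x (p x * f x)%:E +
    \int[m3]_z (sn z)%:E * \int[m1]_x (p x * g x)%:E =
  \int[mu]_w ((p w.1.1 * f w.1.1 * q w.1.2 * st w.2)%:E +
              (p w.1.1 * g w.1.1 * q w.1.2 * sn w.2)%:E).
  by rewrite integralD// E1 E2 q1 !mule1 muleC [X in _ + X]muleC.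
apply: le_integral => //; first exact: integrableD.
move=> -[[x y] z] _; rewrite /pqs /st /sn /=.
(* Where [p] or [s] vanishes both integrands are 0, whatever the value of [H]; elsewhere the
   pointwise bound is multiplied by the nonnegative joint density. *)
have := p0 x; rewrite le_eqVlt => /predU1P[<-|px].
  by rewrite !mul0r mul0e adde0.
have := s0 z; rewrite le_eqVlt => /predU1P[<-|sz].
  by rewrite !mul0r !mulr0 mul0e adde0.
have -> : (p x * f x * q y * (s z * t z))%:E + (p x * g x * q y * (s z * (1 - t z)))%:E
    = (p x * q y * s z)%:E * (t z * f x + (1 - t z) * g x)%:E.
  by rewrite -EFinD -EFinM; congr EFin; ring.
by apply: lee_wpmul2l; [rewrite lee_fin !mulr_ge0|exact: fgH].
Qed.

(** * The hierarchical power prior *)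

Lemma lne_p_hat_ge (R : realType) (dX dZ dB : measure_display)
    (TX : measurableType dX) (TZ : measurableType dZ) (TB : measurableType dB)
    (n k : nat) (M : hpp_model R TX TZ TB n k) (lam : 'rV[R]_n) (r : R) (b : TB) :
  natural_space (global_fam M) lam -> (0 <= r <= 1)%R ->
  (0 < ef_base (global_fam M) b)%R ->
  (r * ln (p_delta M lam b) + (1 - r) * ln (p_u M b))%:E <=
  lne (p_hat M lam r b)%:E.
Proof.
move=> Mlam r01 b0.
have pd0 b' : (0 < p_delta M lam b')%R = (0 < ef_base (global_fam M) b')%R.
  exact: ef_density_gt0.
have pu0 b' : (0 < p_u M b')%R = (0 < ef_base (global_fam M) b')%R.
  exact: ef_density_gt0.
have d_delta : is_density (refB M) (p_delta M lam) by exact: ef_density_is_density.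
have d_u : is_density (refB M) (p_u M) by exact: ef_density_is_density (alpha_uP M).
rewrite /p_hat.
(* The exponential form is forgotten: only two densities with a common support remain. *)
move: (p_delta M lam) (p_u M) pd0 pu0 d_delta d_u => f g f0 g0 df dg.
have fg b' : (0 < f b')%R -> (0 < g b')%R by rewrite f0 g0.
have {f0 g0} [fb0 gb0] : (0 < f b)%R /\ (0 < g b)%R by rewrite f0 g0.
have /andP[Z0 Z1] := Rintegral_powR_mix df dg fg r01.
rewrite lne_EFin; last by rewrite divr_gt0// mulr_gt0// powR_gt0.
rewrite lee_fin ln_div ?posrE ?mulr_gt0 ?powR_gt0//.
(* The two sides now differ by minus the log of the normalizer, which is at most 1. *)
rewrite lnM ?posrE ?powR_gt0// !ln_powR lerDl oppr_ge0.
exact: ln_le0.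
Qed.

Theorem theorem1 (R : realType) (dX dZ dB : measure_display)
    (TX : measurableType dX) (TZ : measurableType dZ) (TB : measurableType dB)
    (n k : nat) (M : hpp_model R TX TZ TB n k)
    (lam : 'rV[R]_n) (phi : phi_index M) (omega : R)
    (x : TX) (lam_prev : 'rV[R]_n)
    (hlam : natural_space (global_fam M) lam)
    (homega : natural_space (rho_fam M) (omega%:M)%R)
    (hlam_prev : natural_space (global_fam M) lam_prev)
    (hfin : expectations_finite lam phi omega x lam_prev) :
  Lhat_HPP lam phi omega x lam_prev <= L_HPP lam phi omega x lam_prev.
Proof.
case: hfin => _ [fin_hat [fin_delta [fin_u _]]].
have beta0 b : (0 < q_beta M lam b)%R -> (0 < ef_base (global_fam M) b)%R.
  by rewrite /q_beta ef_density_gt0.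
have rho01 r : (0 < q_rho M omega r)%R -> (0 <= r <= 1)%R.
  rewrite /q_rho ef_density_gt0; apply: contraLR => /rho_fam_supp ->.
  by rewrite ltxx.
(* By the common support, the extended logarithm of any member of the family is finite wherever
   [q_beta] is positive. This serves both [lam_prev] and [alpha_u]. *)
have ln_density lam' : natural_space (global_fam M) lam' ->
    measurable_fun [set: TB] (fun b => ln (p_delta M lam' b)) /\
    forall b, (0 < q_beta M lam b)%R ->
      lne (p_delta M lam' b)%:E = (ln (p_delta M lam' b))%:E.
  move=> hlam'; split.
    have [m _ _] := ef_density_is_density hlam'.
    exact: (measurableT_comp (@measurable_ln R) m).
  by move=> b /beta0 b0; rewrite lne_EFin// /p_delta ef_density_gt0.
have [m_delta lne_delta] := ln_density _ hlam_prev.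
have [m_u lne_u] := ln_density _ (alpha_uP M).
(* The mixing weight is the forgetting factor itself, hence [id]. *)
have mix_le := @expectation_mix_le R _ _ _ TB TZ (measurableTypeR R)
  (refB M) (refZ M) (@lebesgue_measure R) _ _ _ _ _ _ _ id
  (fun b r => lne (p_hat M lam_prev r b)%:E)
  (ef_density_is_density hlam) (qZP phi) (ef_density_is_density homega)
  m_delta lne_delta m_u lne_u (@measurable_id _ _ _) rho01
  (fun b r b0 r0 => lne_p_hat_ge hlam_prev (rho01 r r0) (beta0 b b0))
  fin_delta fin_u fin_hat.
rewrite /Lhat_HPP /L_HPP.
(* The [p_rho] term and the three entropy terms are common to both sides, as is the likelihood term
   removed next; what remains is [mix_le]. *)
do 4 apply: leeD2r.
by rewrite -addeA; apply: leeD2l.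
Qed.
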